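(* Let $v_T,w_T\in\mathbb R^{d_T}$ be uniformly $\ell_1$-bounded weighting vectors and $Y_{T,j,i}$ the vector time series of the model in the context, with $\alpha_{T,j}\to\alpha_j^*\in(0,\infty)$ and $N_j/N\to\kappa_j\in(0,1]$ for $j=1,\dots,K$ as $T\to\infty$. Let $(\Omega,\mathcal F,P)$ be the product of the original probability spaces $(\Omega^{(j)},\mathcal F^{(j)},P^{(j)})$, $\mathcal M_T=\{(k_1,\dots,k_K)\in\mathbb N_0^K:k_1\le N_1,\dots,k_K\le N_K\}$, and consider the test statistics $$Q_T=\sum_{j=1}^K\max_{k_j\le N_j}\Big(\tfrac1{\alpha_{T,j}}\mathcal D^{(j)}_T\Big(\tfrac{k_j}{N_j}\Big)\Big)^2,\quad V_T=\max_{k\in\mathcal M_T}\Big|\mathcal D_T\Big(\tfrac{k_1}{N_1},\dots,\tfrac{k_K}{N_K}\Big)\Big|,$$ $$\breve Q_T=\sum_{j=1}^K\max_{k_j\le N_j}\Big(\tfrac1{\alpha_{T,j}}\Delta^{(j)}_T\Big(\tfrac{k_j}{N_j}\Big)\Big)^2,\quad\breve V_T=\max_{k\in\mathcal M_T}\Big|\Delta_T\Big(\tfrac{k_1}{N_1},\dots,\tfrac{k_K}{N_K}\Big)\Big|.$$ Suppose that on $(\Omega,\mathcal F,P)$ there exist, for each $T$ (and possibly different in each of the four relations), independent standard Brownian motions $B^{(j)}_T$, $j=1,\dots,K$, with Brownian bridges $\overline B{}^{(j)}_T(s)=B^{(j)}_T(s)-sB^{(j)}_T(1)$, such that, as $T\to\infty$,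 $$\Big|Q_T-\sum_{j=1}^K\max_{k_j\le N_j}\Big(B^{(j)}_T\Big(\tfrac{k_j}{N_j}\Big)\Big)^2\Big|=o_P(1),\qquad\Big|\breve Q_T-\sum_{j=1}^K\max_{k_j\le N_j}\Big(\overline B{}^{(j)}_T\Big(\tfrac{k_j}{N_j}\Big)\Big)^2\Big|=o_P(1),$$ $$\Big|V_T-\max_{k\in\mathcal M_T}\Big|\sum_{j=1}^K\alpha_{T,j}B^{(j)}_T\Big(\tfrac{k_j}{N}\Big)\Big|\Big|=o_P(1),\qquad\Big|\breve V_T-\max_{k\in\mathcal M_T}\Big|\sum_{j=1}^K\alpha_{T,j}\sqrt{\tfrac{N_j}{N}}\,\overline B{}^{(j)}_T\Big(\tfrac{k_j}{N_j}\Big)\Big|\Big|=o_P(1).$$ Let $B^{(1)},\dots,B^{(K)}$ be independent standard Brownian motions and $\overline B{}^{(j)}(s)=B^{(j)}(s)-sB^{(j)}(1)$, $s\in[0,1]$. Then, as $T\to\infty$, the following convergences in distribution hold: (i) $Q_T\stackrel{d}{\longrightarrow}\sum_{j=1}^K\sup_{s_j\in[0,1]}\big(B^{(j)}(s_j)\big)^2$; (ii) $V_T\stackrel{d}{\longrightarrow}\sup_{s\in[0,1]^K}\Big|\sum_{j=1}^K\alpha_j^*\sqrt{\kappa_j}\,B^{(j)}(s_j)\Big|$; (iii) $\breve Q_T\stackrel{d}{\longrightarrow}\sum_{j=1}^K\sup_{s_j\in[0,1]}\big(\overline B{}^{(j)}(s_j)\big)^2$; (iv) $\breve V_T\stackrel{d}{\longrightarrow}\sup_{s\in[0,1]^K}\Big|\sum_{j=1}^K\alpha_j^*\sqrt{\kappa_j}\,\overline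 B{}^{(j)}(s_j)\Big|$.
   Context: Model. $K\in\mathbb N$ is fixed. For $T>0$, $d_T\in\mathbb N$ is an arbitrary dimension (no growth constraint), $\omega_j\in(0,1]$ are fixed sampling frequencies, $N_j=\lfloor\omega_jT\rfloor$, $j=1,\dots,K$, and $N=\sum_{j=1}^KN_j$. The $j$th sample is $Y_{T,j,1},\dots,Y_{T,j,N_j}$, where $Y_{T,j,i}=(Y^{(1)}_{T,j,i},\dots,Y^{(d_T)}_{T,j,i})'$ is a $d_T$-dimensional random vector defined on a probability space $(\Omega^{(j)},\mathcal F^{(j)},P^{(j)})$ with $$Y^{(\nu)}_{T,j,i}=\sum_{l=0}^\infty c^{(\nu)}_{T,j,l}\,\epsilon_{j,i-l},\quad i\ge1,\ \nu=1,\dots,d_T.$$ The real coefficients satisfy $\sup_{T>0}\max_{1\le\nu\le d_T}|c^{(\nu)}_{T,j,l}|^2=\mathcal O(\min\{l^{-3/2-\vartheta_j},1\})$, $l\in\mathbb N_0$, for some $\vartheta_j\in(0,1/2)$. The $\{\epsilon_{j,k}\}_{k\in\mathbb Z}$, $j=1,\dots,K$, are $K$ independent sequences of independent random variables with $E\epsilon_{j,k}=0$, $E\epsilon_{j,k}^2=\sigma_{j,k}^2\in(0,\infty)$ and $\sup_{k}E|\epsilon_{j,k}|^{4+\delta_j}<\infty$ for some $\delta_j>0$. Thus $E(Y_{T,j,i})=0$. Weighting vectors $v_T,w_T$ are uniformly $\ell_1$-bounded if $\sup_{T>0}\|v_T\|_{\ell_1}<\infty$ and $\sup_{T>0}\|w_T\|_{\ell_1}<\infty$.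 Processes. For $k_j\le N_j$ and $t_j\in[0,1]$, $$D^{(j)}_{T,k_j}=v_T'\sum_{i=1}^{k_j}\big(Y_{T,j,i}Y_{T,j,i}'-E(Y_{T,j,i}Y_{T,j,i}')\big)w_T,\qquad\mathcal D^{(j)}_T(t_j)=N_j^{-1/2}D^{(j)}_{T,\lfloor t_jN_j\rfloor},$$ $$\Delta^{(j)}_T(t_j)=\mathcal D^{(j)}_T\Big(\tfrac{\lfloor t_jN_j\rfloor}{N_j}\Big)-\tfrac{\lfloor t_jN_j\rfloor}{N_j}\mathcal D^{(j)}_T(1),\qquad\mathcal D_T(t_1,\dots,t_K)=N^{-1/2}\sum_{j=1}^KD^{(j)}_{T,\lfloor t_jN_j\rfloor},$$ $$\Delta_T(t_1,\dots,t_K)=\mathcal D_T(t_1,\dots,t_K)-\frac1{\sqrt N}\sum_{j=1}^K\frac{\lfloor t_jN_j\rfloor}{\sqrt{N_j}}\mathcal D^{(j)}_T(1).$$ When the argument is $k_j/N_j$, $\lfloor t_jN_j\rfloor$ is read as $k_j$. Long-run variance. With $\eta_{T,j,k}=(v_T'Y_{T,j,k})(w_T'Y_{T,j,k})-E[(v_T'Y_{T,j,k})(w_T'Y_{T,j,k})]$, $\alpha_{T,j}^2=\lim_{n\to\infty}\mathrm{Var}\big(n^{-1/2}\sum_{k=1}^n\eta_{T,j,k}\big)$ is the long-run variance of this series at horizon $T$; it is assumed to exist and to be strictly positive, and $\alpha_{T,j}>0$ is its square root. $o_P(1)$ means convergence to $0$ in probability. *)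

(* Defs.v *)
From HB Require Import structures.
From mathcomp Require Import all_boot all_order all_algebra.
From mathcomp Require Import all_classical all_reals all_analysis.

Set Implicit Arguments.
Unset Strict Implicit.
Unset Printing Implicit Defensive.

Import Order.TTheory GRing.Theory Num.Theory.
Import numFieldNormedType.Exports.

Local Open Scope classical_set_scope.
Local Open Scope ring_scope.

Section Independence.
Context {R : realType} {d : measure_display} {Om : measurableType d}.
Variable P : probability Om R.

Definition independent_sets {I : eqType} (F : I -> set (set Om)) : Prop :=
  forall (s : seq I) (A : I -> set Om), uniq s ->
    (forall i, i \in s -> F i (A i)) ->
    P (\bigcap_(i in [set` s]) A i) = (\prod_(i <- s) P (A i))%E.

Definition sigma_process {I : Type} (J : set I) (X : I -> Om -> R) :
    set (set Om) :=
  <<s \bigcup_(t in J) preimage_set_system setT (X t) measurable >>.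

Definition independent_rvs {I : eqType} (X : I -> Om -> R) : Prop :=
  independent_sets (fun i => preimage_set_system setT (X i) measurable).

End Independence.

Section BrownianMotion.
Context {R : realType} {d : measure_display} {Om : measurableType d}.
Variable P : probability Om R.

(* Time horizon [0, 1]; the values of [B] at other times are irrelevant.
   [normal_prob m s] takes the standard deviation [s].  The increments over
   t_0 <= ... <= t_n are those of the sequence that stays at t_n from then on,
   a constant increment being independent of everything. *)
Definition standard_brownian (B : R -> Om -> R) : Prop :=
  [/\ forall t : R, 0 <= t <= 1 -> measurable_fun setT (B t),
      {ae P, forall x, B 0 x = 0},
      forall t : nat -> R, (forall i, 0 <= t i <= 1) ->
        (forall i, t i <= t i.+1) ->
        independent_rvs P (fun (i : nat) x => B (t i.+1) x - B (t i) x),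
      forall s t : R, 0 <= s -> s < t -> t <= 1 ->
        forall A : set R, measurable A ->
        P ((fun x => B t x - B s x) @^-1` A)
          = normal_prob 0 (Num.sqrt (t - s)) A
    & forall x, {within `[0, 1]%classic, continuous (fun t => B t x)}].

Definition independent_brownians {K : nat} (B : 'I_K -> R -> Om -> R) : Prop :=
  (forall j, standard_brownian (B j)) /\
  independent_sets P (fun j => sigma_process `[0, 1]%classic (B j)).

Definition bridge (B : R -> Om -> R) (s : R) (x : Om) : R := B s x - s * B 1 x.

End BrownianMotion.

Section Convergence.
Context {R : realType} {d : measure_display} {Om : measurableType d}.
Variable P : probability Om R.

Definition oP1 (X : R -> Om -> R) : Prop :=
  forall e : R, 0 < e -> P [set x | e < `|X T x|] @[T --> +oo] --> 0%E.

Definition cvg_in_distribution (X : R -> Om -> R)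
    {d'} {Om' : measurableType d'} (P' : probability Om' R) (Y : Om' -> R) :
    Prop :=
  [/\ forall T : R, 0 < T -> measurable_fun setT (X T),
      measurable_fun setT Y
    & forall f : R -> R, continuous f -> (exists c : R, forall z, `|f z| <= c) ->
        'E_P[f \o X T]%E @[T --> +oo] --> 'E_P'[f \o Y]%E].

End Convergence.

Section ProductSpace.
Context {R : realType} {K : nat} {d : 'I_K -> measure_display}.
Variable Om : forall j, measurableType (d j).

Definition cylinders : set (set (forall j, Om j)) :=
  \bigcup_(j in [set: 'I_K])
    preimage_set_system setT (fun x : forall j, Om j => x j) measurable.

Definition prod_space := g_sigma_algebraType cylinders.

(* Rectangles form a pi-system generating the product sigma-algebra, so this
   determines [P] uniquely. *)
Definition is_product_probability (Pj : forall j, probability (Om j) R)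
    (P : probability prod_space R) : Prop :=
  forall A : (forall j, set (Om j)), (forall j, measurable (A j)) ->
    P [set x : prod_space | forall j, A j (x j)] = (\prod_j Pj j (A j))%E.

End ProductSpace.

(* min {l^{-3/2-theta}, 1}, with 0^{-3/2-theta} = +oo: [powR] has
   0 `^ a = 0 for every a <> 0. *)
Definition coef_rate {R : realType} (theta : R) (l : nat) : R :=
  if l is 0%N then 1 else Num.min (l%:R `^ (- (3 / 2) - theta)) 1.

Unset Implicit Arguments.

(* The horizon T ranges over the positive reals; nothing is assumed on the
   fields at T <= 0, nor on [obs] at time index 0.  The K innovation sequences
   live on K distinct probability spaces: their mutual independence is that of
   the coordinates of the product space.  Under the moment and coefficient
   assumptions the linear series converge almost surely and in L^2, in general
   not absolutely. *)
Record model (R : realType) (K : nat) := Model {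
  dimT : R -> nat ;
  freq : 'I_K -> R ;
  disp : 'I_K -> measure_display ;
  sample_space : forall j, measurableType (disp j) ;
  sample_prob : forall j, probability (sample_space j) R ;
  coef : forall T, 'I_K -> 'I_(dimT T) -> nat -> R ;
  innov : forall j, int -> {RV (sample_prob j) >-> R} ;
  obs : forall T j, nat -> 'I_(dimT T) -> {RV (sample_prob j) >-> R} ;
  dimT_gt0 : forall T : R, 0 < T -> (0 < dimT T)%N ;
  freq_itv : forall j, 0 < freq j <= 1 ;
  coef_bound : forall j, exists2 theta : R, 0 < theta < 1 / 2 &
    exists C : R, forall (T : R) nu l, 0 < T ->
      `|coef T j nu l| ^+ 2 <= C * coef_rate theta l ;
  innov_independent : forall j,
    independent_rvs (sample_prob j)
      (fun k => innov j k : sample_space j -> R) ;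
  innov_mean : forall j k, ('E_(sample_prob j)[innov j k] = 0)%E ;
  innov_var : forall j k,
    (0 < 'E_(sample_prob j)[fun x => (innov j k x ^+ 2)%R] < +oo)%E ;
  innov_moment : forall j, exists2 delta : R, 0 < delta &
    (ereal_sup
       [set 'E_(sample_prob j)[fun x => (`|innov j k x| `^ (4 + delta))%R]
       | k in [set: int]] < +oo)%E ;
  obs_linear : forall (T : R) j i nu, 0 < T -> (0 < i)%N ->
    {ae sample_prob j, forall x,
      [series coef T j nu l * innov j (i%:Z - l%:Z) x]_l @ \oo
        --> obs T j i nu x} }.

Set Implicit Arguments.

Arguments dimT {R K}.
Arguments freq {R K}.
Arguments sample_space {R K}.
Arguments sample_prob {R K}.
Arguments coef {R K}.
Arguments innov {R K}.
Arguments obs {R K}.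

Section Samples.
Context {R : realType} {K : nat}.
Variable M : model R K.

Definition sample_size (T : R) (j : 'I_K) : nat := Num.truncn (freq M j * T).
Definition total_size (T : R) : nat := \sum_j sample_size T j.

Definition obs_vec (T : R) (j : 'I_K) (i : nat) (x : sample_space M j) :
    'cV[R]_(dimT M T) :=
  \col_nu obs M T j i nu x.

Definition second_moment (T : R) (j : 'I_K) (i : nat) : 'M[R]_(dimT M T) :=
  \matrix_(nu, mu)
    fine 'E_(sample_prob M j)[fun x => obs M T j i nu x * obs M T j i mu x].

Definition weights := forall T : R, 'cV[R]_(dimT M T).

Definition l1_bounded (v : weights) : Prop :=
  exists C : R, forall T : R, 0 < T -> \sum_nu `|v T nu 0| <= C.

Variables v w : weights.

Definition eta (T : R) (j : 'I_K) (k : nat) (x : sample_space M j) : R :=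
  let Z y := ((v T)^T *m obs_vec T k y) 0 0 * ((w T)^T *m obs_vec T k y) 0 0 in
  Z x - fine 'E_(sample_prob M j)[Z].

Definition is_long_run_variance (T : R) (j : 'I_K) (a2 : R) : Prop :=
  variance (sample_prob M j) (fun x : sample_space M j =>
      (Num.sqrt n%:R)^-1 * \sum_(1 <= k < n.+1) eta T k x)
    @[n --> \oo] --> a2%:E.

Definition Dsum (T : R) (j : 'I_K) (k : nat) (x : sample_space M j) : R :=
  ((v T)^T *m (\sum_(1 <= i < k.+1)
     (obs_vec T i x *m (obs_vec T i x)^T - second_moment T j i)) *m w T) 0 0.

(* Division by zero gives zero, so that t = k / N_j yields floor (t N_j) = k
   for every k <= N_j, also when N_j = 0. *)
Definition step (T : R) (j : 'I_K) (t : R) : nat :=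
  Num.truncn (t * (sample_size T j)%:R).

Definition Dproc (T : R) (j : 'I_K) (t : R) (x : sample_space M j) : R :=
  (Num.sqrt (sample_size T j)%:R)^-1 * Dsum T (step T j t) x.

Definition Deltaproc (T : R) (j : 'I_K) (t : R) (x : sample_space M j) : R :=
  let u := (step T j t)%:R / (sample_size T j)%:R in
  Dproc T u x - u * Dproc T 1 x.

Definition Dpooled (T : R) (t : 'I_K -> R) (x : prod_space (sample_space M)) : R :=
  (Num.sqrt (total_size T)%:R)^-1 * \sum_j Dsum T (step T j (t j)) (x j).

Definition Deltapooled (T : R) (t : 'I_K -> R) (x : prod_space (sample_space M)) : R :=
  Dpooled T t x - (Num.sqrt (total_size T)%:R)^-1 *
    \sum_j (step T j (t j))%:R / Num.sqrt (sample_size T j)%:R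
             * Dproc T 1 (x j).

(* k_j / N_j. *)
Definition grid (T : R) (j : 'I_K) (k : nat) : R := k%:R / (sample_size T j)%:R.

(* The multi-indices k in N_0^K with k_j <= N_j for all j. *)
Definition multi_index (T : R) : finType :=
  {dffun forall j : 'I_K, 'I_(sample_size T j).+1}.

(* All maxima below are over nonempty finite families of nonnegative reals,
   hence the default value 0. *)

Variable alpha : R -> 'I_K -> R.

Definition Qstat (T : R) (x : prod_space (sample_space M)) : R :=
  \sum_j \big[Num.max/0]_(k < (sample_size T j).+1)
    ((alpha T j)^-1 * Dproc T (grid T j k) (x j)) ^+ 2.

Definition Vstat (T : R) (x : prod_space (sample_space M)) : R :=
  \big[Num.max/0]_(k : multi_index T)
    `|Dpooled T (fun j => grid T j (k j)) x|.

Definition Qbreve (T : R) (x : prod_space (sample_space M)) : R :=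
  \sum_j \big[Num.max/0]_(k < (sample_size T j).+1)
    ((alpha T j)^-1 * Deltaproc T (grid T j k) (x j)) ^+ 2.

Definition Vbreve (T : R) (x : prod_space (sample_space M)) : R :=
  \big[Num.max/0]_(k : multi_index T)
    `|Deltapooled T (fun j => grid T j (k j)) x|.

End Samples.

(* [0, 1]^K *)
Definition unit_cube {R : realType} (K : nat) : set ('I_K -> R) :=
  [set s : 'I_K -> R | forall j, 0 <= s j <= 1].

Arguments unit_cube {R} K _.

(* Main.v *)
Require Import Defs.
From mathcomp Require Import all_boot all_order all_algebra.
From mathcomp Require Import all_classical all_reals all_analysis.
From mathcomp Require Import measurable_realfun ring lra.

Set Implicit Arguments.
Unset Strict Implicit.
Unset Printing Implicit Defensive.

Import Order.TTheory GRing.Theory Num.Theory.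
Import numFieldNormedType.Exports.

Local Open Scope classical_set_scope.
Local Open Scope ring_scope.

(** Each statistic is within o_P(1) of a functional Phi_T of Brownian motions
that live on the same probability space and depend on T, but Phi_T reads their
paths only at finitely many grid points. The joint law of finitely many values
of independent Brownian motions does not depend on the space that carries them,
so Phi_T of those motions has, for every T, the same law as Phi_T of the fixed
motions B. Along the fixed motions nothing random remains to be controlled:
for every outcome the paths are continuous, the grid becomes dense in [0, 1],
and the maximum over the grid converges to the supremum. Hence Phi_T(B)
converges surely to the limit variable, and its law, which is the law of
Phi_T of the T-dependent motions, converges weakly. The o_P(1) error is absorbed
by a Slutsky argument.

The second statistic reads the motions at k / N, the fixed motion at k / N_j.
The two are reconciled by Brownian scaling: sqrt (N_j / N) B(k / N_j),
0 <= k <= N_j, has the law of the values of a Brownian motion at k / N. This is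
why the equality in law is proved between B at one grid and a multiple c B' at
another ([brownian_scaling]); for the other three statistics the two grids are
the same and c = 1.

The carrying lemmas are [slutsky], [brownian_scaling], the deterministic
[cvg_bigmax_sup] with its two instances [cvg_grid_max] and
[cvg_grid_max_multi], and [brownian_functional_limit], which combines them. *)

(** * Weak convergence and Slutsky's lemma *)

Section Expectation.
Context {R : realType} {d : measure_display} {Om : measurableType d}.
Variable P : probability Om R.

Lemma bounded_integrable (X : Om -> R) (c : R) : measurable_fun setT X ->
  (forall x, `|X x| <= c) -> P.-integrable setT (EFin \o X).
Proof.
move=> mX Xc; apply: measurable_bounded_integrable => //.
  by rewrite (le_lt_trans (probability_le1 _ _)) ?ltry.
exists c; split; first exact: num_real.
by move=> M cM x _ /=; rewrite (le_trans (Xc x))// ltW.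
Qed.

Lemma expectation_Rintegral (X : Om -> R) (c : R) : measurable_fun setT X ->
  (forall x, `|X x| <= c) -> ('E_P[X])%E = (\int[P]_x X x)%:E.
Proof.
move=> mX Xc; rewrite unlock /Rintegral fineK//.
exact: integrable_fin_num (bounded_integrable mX Xc).
Qed.

Lemma continuous_comp_measurable (f : R -> R) (X : Om -> R) :
  continuous f -> measurable_fun setT X -> measurable_fun setT (f \o X).
Proof.
move=> cf mX; apply: measurableT_comp => //.
exact: continuous_measurable_fun.
Qed.

(** A limit at +oo along the reals amounts to limits along all sequences tending
to +oo, to each of which dominated convergence applies. *)
Lemma bounded_convergence_pinfty (X : R -> Om -> R) (Y : Om -> R) (c : R) :
  (forall T, measurable_fun setT (X T)) -> (forall T x, `|X T x| <= c) ->
  (forall x, X T x @[T --> +oo] --> Y x) ->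
  \int[P]_x X T x @[T --> +oo] --> \int[P]_x Y x.
Proof.
move=> mX Xc XY; apply/cvg_pinftyP => u u_oo.
have XuY x : X (u n) x @[n --> \oo] --> Y x.
  exact: (cvg_comp u (X^~ x) u_oo (XY x)).
have XuYE x : (X (u n) x)%:E @[n --> \oo] --> (Y x)%:E.
  by apply: cvg_EFin; [exact: nearW|exact: XuY].
have mY : measurable_fun setT Y.
  apply: (@measurable_fun_cvg _ _ _ _ (fun n => X (u n))) => // n; exact: mX.
have Yc x : `|Y x| <= c.
  have nXuY : `|X (u n) x| @[n --> \oo] --> `|Y x| by exact: cvg_norm.
  rewrite -(cvg_lim _ nXuY)//; apply: limr_le; first exact: cvgP nXuY.
  by apply: nearW => n /=; exact: Xc.
have iY := integrable_fin_num measurableT (bounded_integrable mY Yc).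
have [_ _] := @dominated_convergence _ _ _ P setT measurableT
  (fun n x => (X (u n) x)%:E) (EFin \o Y) (cst c%:E)
  (fun n => proj2 (measurable_EFinP _ _) (mX (u n)))
  (proj2 (measurable_EFinP _ _) mY)
  (aeW P (fun x _ => XuYE x))
  (finite_measure_integrable_cst P c measurableT)
  (aeW P (fun x n _ => Xc (u n) x)).
by rewrite -(fineK iY) => /fine_cvgP[].
Qed.

Lemma Rintegral_indic (A : set Om) : measurable A ->
  \int[P]_x (\1_A x) = fine (P A).
Proof. by move=> mA; rewrite /Rintegral integral_indic// setIT. Qed.

Lemma Rintegral_probability_cst (r : R) : \int[P]_x r = r.
Proof. by have := expectation_cst P r; rewrite unlock /Rintegral => ->. Qed.

End Expectation.

(** Heine's theorem in the one-sided form that [slutsky] needs: only [x] is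
confined to the segment, so that the perturbed variable need not be. *)
Lemma continuous_unif_segment {R : realType} (f : R -> R) (M e : R) :
  continuous f -> 0 < e -> exists2 del : R, 0 < del &
    forall x y, `|x| <= M -> `|x - y| <= del -> `|f x - f y| <= e.
Proof.
move=> cf e0.
pose Q (del x : R) := forall y, `|x - y| <= del -> `|f x - f y| <= e.
have : near_covering `[- M, M] by apply/compact_near_coveringP/segment_compact.
move=> /(_ R 0^'+ Q _)[].
  move=> x _; have /cvgrPdist_le/(_ (e / 2)) := cf x.
  rewrite divr_gt0// => /(_ isT)[r /= r0 xr].
  exists (ball x (r / 2), [set del | del < r / 2]); first split => /=.
  - by apply: nbhsx_ballx; rewrite divr_gt0.
  - by apply: nbhs_right_lt; rewrite divr_gt0.
  move=> -[x' del] /= [xx' delr] y yx'.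
  rewrite (le_trans (ler_distD (f x) _ _))// [leRHS]splitr lerD//.
    rewrite distrC; apply: xr => /=.
    by rewrite (lt_le_trans xx')//; lra.
  apply: xr => /=.
  rewrite (le_lt_trans (ler_distD x' _ _))// [ltRHS]splitr.
  by rewrite ltrD// (le_lt_trans yx').
move=> r /= r0 rQ.
exists (r / 2); first by rewrite divr_gt0.
move=> x y xM; apply: rQ => /=.
- by rewrite sub0r normrN gtr0_norm ?divr_gt0//; lra.
- by rewrite divr_gt0.
- by rewrite in_itv/= -ler_norml.
Qed.

Section Slutsky.
Context {R : realType} {d d' : measure_display}
  {Om : measurableType d} {Om' : measurableType d'}.
Variables (P : probability Om R) (P' : probability Om' R).

(** The indicator of `|x| > M, made continuous on M <= `|x| <= M + 1: it turns
the tightness of a weakly convergent family into the convergence of one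
expectation. *)
Let cutoff (M x : R) := Num.min 1 (Num.max 0 (`|x| - M)).

Let cutoff_continuous M : continuous (cutoff M).
Proof.
have cmax : continuous (fun x : R => Num.max 0 (`|x| - M)).
  move=> x; apply: (@continuous_max _ _ (cst 0) (fun x : R => `|x| - M)).
    exact: cst_continuous.
  by apply: cvgB; [exact: norm_continuous|exact: cvg_cst].
move=> x.
have c1 : {for x, continuous (cst 1 : R -> R^o)} by exact: cst_continuous.
exact: (continuous_min c1 (cmax x)).
Qed.

Let cutoff_ge0 M x : 0 <= cutoff M x.
Proof. by rewrite /cutoff le_min ler01 le_max lexx. Qed.

Let cutoff_bounded M x : `|cutoff M x| <= 1.
Proof. by rewrite ger0_norm// /cutoff ge_min lexx. Qed.

Let cutoff_eq1 M x : M + 1 < `|x| -> cutoff M x = 1.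
Proof. by move=> ?; rewrite /cutoff; apply/min_idPl; rewrite le_max; lra. Qed.

(** A bounded continuous f need not be uniformly continuous, so the line is
split. Where `|X| <= M + 1 and `|Z - X| <= del, uniform continuity of f on a
segment gives `|f Z - f X| <= e. Elsewhere this difference is at most 2 c, and
the event is controlled by the cutoff of X, whose expectation tends to that of the
cutoff of Y, and by P(`|Z - X| > del), which tends to 0. *)
Lemma slutsky (X Z : R -> Om -> R) (Y : Om' -> R) :
  (\forall T \near +oo, measurable_fun setT (X T)) ->
  (\forall T \near +oo, measurable_fun setT (Z T)) ->
  measurable_fun setT Y ->
  (forall f : R -> R, continuous f -> (exists c : R, forall z, `|f z| <= c) ->
    \int[P]_x f (X T x) @[T --> +oo] --> \int[P']_x f (Y x)) ->
  oP1 P (fun T x => `|Z T x - X T x|) ->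
  forall f : R -> R, continuous f -> (exists c : R, forall z, `|f z| <= c) ->
    \int[P]_x f (Z T x) @[T --> +oo] --> \int[P']_x f (Y x).
Proof.
move=> mX mZ mY XY ZX f cf [c fc].
have c0 : 0 <= c by rewrite (le_trans _ (fc 0)).
have fb : exists c : R, forall z, `|f z| <= c by exists c.
apply: cvg_sub0 (XY f cf fb).
apply/cvgr0Pnorm_le => e0 e0_gt0 /=.
(* The final bound is e + 2 c e + 2 c e. *)
pose e := e0 / (1 + 4 * c).
have e_gt0 : 0 < e by rewrite divr_gt0//; lra.
have [M YM] : exists M : R, \int[P']_x cutoff M (Y x) < e.
  have : \int[P']_x cutoff M (Y x) @[M --> +oo] --> \int[P']_x 0.
    apply: (@bounded_convergence_pinfty _ _ _ _ _ _ 1) => //=.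
      by move=> M; exact: continuous_comp_measurable.
    move=> x; apply: cvg_near_cst; near=> M.
    rewrite /cutoff (_ : Num.max 0 _ = 0); first by apply/min_idPr.
    by apply/max_idPl; rewrite subr_le0; near: M; exact: nbhs_pinfty_ge.
  rewrite Rintegral_probability_cst => /cvgr_lt/(_ _ e_gt0) Me.
  by have [M ?] := filter_ex Me; exists M.
have [del del0 fdel] := continuous_unif_segment (M + 1) cf e_gt0.
have YM1 := XY _ (@cutoff_continuous M) (ex_intro _ 1 (cutoff_bounded M)).
have /fine_cvgP[_ /cvgr_lt/(_ _ e_gt0) ZXe] := ZX del del0.
near=> T.
have PA : fine (P [set x | del < `| `|Z T x - X T x| |]) < e by near: T.
have XM : \int[P]_x cutoff M (X T x) < e.
  by near: T; exact: (cvgr_lt _ YM1).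
have mXT : measurable_fun setT (X T) by near: T.
have mZT : measurable_fun setT (Z T) by near: T.
pose A := [set x | del < `| `|Z T x - X T x| | ].
have mA : measurable A.
  have mD : measurable_fun setT (fun x => `| `|Z T x - X T x| |).
    apply: measurableT_comp => //.
    by apply: measurableT_comp => //; apply: measurable_funB.
  rewrite (_ : A = setT `&` (fun x => `| `|Z T x - X T x| |) @^-1` `]del, +oo[).
    by apply: mD.
  by rewrite setTI; apply/seteqP; split=> x /=; rewrite in_itv/= andbT.
have mfX := continuous_comp_measurable cf mXT.
have mfZ := continuous_comp_measurable cf mZT.
have mgX := continuous_comp_measurable (@cutoff_continuous M) mXT.
have fXc x : `|(f \o X T) x| <= c by exact: fc.
have fZc x : `|(f \o Z T) x| <= c by exact: fc.
have gX1 x : `|(cutoff M \o X T) x| <= 1 by exact: cutoff_bounded.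
have m1A : measurable_fun setT (\1_A : Om -> R) by exact: measurable_indic.
have A1 x : `|(\1_A x : R)| <= 1.
  by rewrite indicE; case: (_ \in _); rewrite ?normr0 ?normr1.
have iX := bounded_integrable P mfX fXc.
have iZ := bounded_integrable P mfZ fZc.
have iM := bounded_integrable P mgX gX1.
have iA := bounded_integrable P m1A A1.
have iD : P.-integrable setT (EFin \o (fun x => f (Z T x) - f (X T x))).
  exact: integrableB iZ iX.
rewrite !fctE /= -RintegralB// (le_trans (le_normr_Rintegral _ _))//.
(* The pointwise majorant of `|f Z - f X|. *)
pose h x := e + (2 * c * \1_A x + 2 * c * cutoff M (X T x)).
have ie : P.-integrable setT (EFin \o (fun=> e)).
  exact: finite_measure_integrable_cst.
have icA : P.-integrable setT (EFin \o (fun x => 2 * c * \1_A x)).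
  exact: integrableZl iA.
have icM : P.-integrable setT (EFin \o (fun x => 2 * c * cutoff M (X T x))).
  exact: integrableZl iM.
have icAM : P.-integrable setT
    (EFin \o (fun x => 2 * c * \1_A x + 2 * c * cutoff M (X T x))).
  exact: integrableD icA icM.
have ih : P.-integrable setT (EFin \o h) by exact: integrableD ie icAM.
apply: (@le_trans _ _ (\int[P]_x h x)).
  apply: le_Rintegral => // [|x _]; first exact: integrable_norm iD.
  have A0 : 0 <= (\1_A x : R) by rewrite indicE.
  have M0 := cutoff_ge0 M (X T x).
  have fXZ : `|f (Z T x) - f (X T x)| <= 2 * c.
    rewrite (le_trans (ler_normB _ _))//.
    by have := fZc x; have := fXc x => /= ? ?; lra.
  have cA0 : 0 <= 2 * c * \1_A x by rewrite mulr_ge0//; lra.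
  have cM0 : 0 <= 2 * c * cutoff M (X T x) by rewrite mulr_ge0//; lra.
  rewrite /h; have [xM|Mx] := leP `|X T x| (M + 1); last first.
    by rewrite (cutoff_eq1 Mx) mulr1 in cM0 *; lra.
  have [xdel|delx] := leP `| `|Z T x - X T x| | del; last first.
    suff A1' : \1_A x = 1 :> R by rewrite A1' mulr1 in cA0 *; lra.
    by rewrite indicE mem_set.
  have := fdel (X T x) (Z T x) xM.
  rewrite normr_id in xdel; rewrite distrC => /(_ xdel).
  by rewrite distrC; lra.
rewrite /h RintegralD// RintegralD// Rintegral_probability_cst !RintegralZl//.
rewrite Rintegral_indic//.
have ee0 : e0 = e + (2 * c * e + 2 * c * e).
  by rewrite /e; field; lra.
have c20 : 0 <= 2 * c by lra.
rewrite [leRHS]ee0 lerD2l; apply: lerD; apply: ler_wpM2l => //; exact: ltW.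
Unshelve. all: by end_near. Qed.

End Slutsky.

(** * Equality in law of Brownian motions on grids *)

Section NormalScaling.
Context {R : realType}.

Lemma normal_pdf_scale (c s x : R) : 0 < c -> 0 < s ->
  normal_pdf 0 (c * s) (c * x) * c = normal_pdf 0 s x.
Proof.
move=> c0 s0; rewrite !normal_pdfE ?mulf_neq0 ?gt_eqF//.
rewrite /normal_peak /normal_fun !subr0 mulrAC; congr (_ * expR _).
  rewrite exprMn -mulrA -mulrnAr sqrtrM ?sqr_ge0// sqrtr_sqr gtr0_norm//.
  by rewrite invfM mulrAC mulVf ?mul1r// gt_eqF.
by field; rewrite !gt_eqF.
Qed.

(** The density identity integrates over half-open intervals by the change of
variables x |-> c x, and these generate the Borel sets. *)
Lemma normal_prob_scale (c s : R) (A : set R) : 0 < c -> 0 < s ->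
  measurable A -> normal_prob 0 s ((fun x => c * x) @^-1` A) =
    normal_prob 0 (c * s) A.
Proof.
move=> c0 s0 mA; have cs0 : 0 < c * s by exact: mulr_gt0.
have mc0 : measurable_fun setT (fun x : R => c * x) by exact: measurable_funM.
have mc : @measurable_fun _ _ (measurableTypeR R) (measurableTypeR R) setT
  (fun x : R => c * x) by exact: mc0.
pose g (k : nat) : set R := `]- k%:R, k%:R]%classic.
(* Normal laws are measures on the type of reals that carries the generated
   sigma-algebra of half-open intervals, so c * _ is read on that type. *)
pose m : {mfun measurableTypeR R >-> measurableTypeR R} :=
  @mfun_Sub _ _ (measurableTypeR R) (measurableTypeR R) _ (mem_set mc).
suff: distribution (normal_prob 0 s) m A = normal_prob 0 (c * s) A by [].
apply: (@measure_unique _ R (measurableTypeR R) (@ocitv R) g erefl (@ocitvI R)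
  _ _ (distribution (normal_prob 0 s) m) (normal_prob 0 (c * s))) => //.
- by move=> k; exact: is_ocitv.
- apply/seteqP; split=> // x _; exists (Num.truncn `|x|).+1 => //=.
  have := truncnS_gt `|x|; rewrite ltr_norml => /andP[xl xr].
  by rewrite /g /= in_itv/= xl ltW.
- move=> _ [[a b] _ <-] /=.
  have [ba|ab] := leP b a.
    by rewrite set_itv_ge ?bnd_simp -?leNgt// !measure0.
  have F'E : (fun x : R => c * x)^`()%classic = cst c.
    apply/funext => x; rewrite derive1E deriveM// derive_id derive_cst.
    by rewrite scaler0 addr0 scaler1.
  have mpdf (r x y : R) (b0 b1 : bool) : measurable_fun
      [set` Interval (BSide b0 x) (BSide b1 y)]
      (fun x => (normal_pdf 0 r x)%:E).
    apply: measurable_funTS; apply/measurable_EFinP.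
    exact: measurable_normal_pdf.
  rewrite /pushforward /normal_prob.
  rewrite (_ : _ @^-1` _ = `]a / c, b / c]%classic); last first.
    apply/seteqP; split=> x /=;
      by rewrite !in_itv/= ler_pdivlMr// ltr_pdivrMr// mulrC.
  rewrite !integral_itv_obnd_cbnd//.
  have := @integration_by_substitution_increasing R (fun x : R => c * x)
    (normal_pdf 0 (c * s)) (a / c) (b / c).
  rewrite F'E.
  have Ea : c * (a / c) = a by field; rewrite gt_eqF.
  have Eb : c * (b / c) = b by field; rewrite gt_eqF.
  have cc x : c * y @[y --> x] --> c * x by exact: mulrl_continuous.
  rewrite Ea Eb.
  move=> ->.
  - by apply: eq_integral => x _ /=; rewrite -(normal_pdf_scale x c0 s0).
  - by rewrite ler_pM2r ?invr_gt0// ltW.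
  - by move=> x y _ _ xy; rewrite ltr_pM2l.
  - by move=> x _; exact: cst_continuous.
  - exact: is_cvg_cst.
  - exact: is_cvg_cst.
  - split.
    + by move=> x _; exact: derivableM.
    + by have := cc (a / c); rewrite Ea => /cvg_at_right_filter.
    + by have := cc (b / c); rewrite Eb => /cvg_at_left_filter.
  - apply: continuous_subspaceT => x.
    by apply: continuous_normal_pdf; rewrite gt_eqF.

- move=> k; rewrite (le_lt_trans (probability_le1 _ _)) ?ltry//.
  by apply: sub_sigma_algebra; exact: is_ocitv.
Qed.
End NormalScaling.

Section PathSpace.
Context {R : realType} {K : nat}.

Definition grid_path := 'I_K -> nat -> R.

Definition path_rectangle (A : 'I_K -> nat -> set R) : set grid_path :=
  [set p | forall j i, A j i (p j i)].

(** A single sequence of times per motion serves every T: rectangles constrain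
finitely many indices, yet indices are natural numbers without a bound
depending on T. *)
Definition path_cylinders : set (set grid_path) :=
  [set C | exists (n : nat) (A : 'I_K -> nat -> set R),
    [/\ forall j i, measurable (A j i), forall j i, (n <= i)%N -> A j i = setT
      & C = path_rectangle A]].

Definition path_space := g_sigma_algebraType path_cylinders.

Lemma path_cylindersI : setI_closed path_cylinders.
Proof.
move=> _ _ [n [A [mA An ->]]] [m [B [mB Bm ->]]].
exists (maxn n m), (fun j i => A j i `&` B j i); split.
- by move=> j i; exact: measurableI.
- by move=> j i; rewrite geq_max => /andP[ni mi]; rewrite An// Bm// setIT.
- apply/seteqP; split=> p /=; first by move=> [Ap Bp] j i; split.
  by move=> ABp; split=> j i; have [] := ABp j i.
Qed.

Lemma measurable_path_coord j i :
  measurable_fun setT (fun p : path_space => p j i).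
Proof.
move=> _ B mB; rewrite setTI; apply: sub_sigma_algebra.
exists i.+1, (fun j' i' => if (j' == j) && (i' == i) then B else setT); split.
- by move=> j' i'; case: ifP.
- by move=> j' i' ii'; rewrite (gtn_eqF ii') andbF.
- apply/seteqP; split=> p /=; last by move=> /(_ j i); rewrite !eqxx.
  by move=> Bp j' i'; case: ifP => // /andP[/eqP -> /eqP ->].
Qed.

Lemma measurable_path_rectangle {d : measure_display} {T : measurableType d}
    (X : T -> grid_path) (A : 'I_K -> nat -> set R) :
  (forall j i, measurable_fun setT (fun x => X x j i)) ->
  (forall j i, measurable (A j i)) -> measurable (X @^-1` path_rectangle A).
Proof.
move=> mX mA.
rewrite (_ : _ @^-1` _ = \bigcap_i \bigcap_(j in [set: 'I_K])
    (setT `&` (fun x => X x j i) @^-1` A j i)).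
  apply: bigcap_measurableType => i _; apply: fin_bigcap_measurable => // j _.
  exact: mX.
apply/seteqP; split=> x /= XA; first by move=> i _ j _; split=> //; exact: XA.
by move=> j i; have [] := XA i I j I.
Qed.

Lemma measurable_path {d : measure_display} {T : measurableType d}
    (X : T -> grid_path) :
  (forall j i, measurable_fun setT (fun x => X x j i)) ->
  measurable_fun setT (X : T -> path_space).
Proof.
move=> mX; apply: (@measurability _ _ T path_space setT X path_cylinders) => //.
move=> _ [_ [n [A [mA _ ->]]] <-]; rewrite setTI.
exact: measurable_path_rectangle.
Qed.

(** Two laws that agree on a pi-system agree; it is enough to compare the
probabilities of finite rectangles. *)
Lemma path_law_unique {d d' : measure_display} {T : measurableType d}
    {T' : measurableType d'} (P : probability T R) (P' : probability T' R)
    (X : T -> grid_path) (X' : T' -> grid_path) :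
  (forall j i, measurable_fun setT (fun x => X x j i)) ->
  (forall j i, measurable_fun setT (fun x => X' x j i)) ->
  (forall C, path_cylinders C -> P (X @^-1` C) = P' (X' @^-1` C)) ->
  forall (phi : path_space -> R) (c : R), measurable_fun setT phi ->
  (forall p, `|phi p| <= c) ->
  (\int[P]_x phi (X x))%R = (\int[P']_x phi (X' x))%R.
Proof.
move=> mX mX' XX' phi c mphi phic.
pose Y : {mfun T >-> path_space} := mfun_Sub (mem_set (measurable_path mX)).
pose Y' : {mfun T' >-> path_space} := mfun_Sub (mem_set (measurable_path mX')).
have mE : measurable_fun setT (EFin \o phi) by exact/measurable_EFinP.
have iX : P.-integrable setT ((EFin \o phi) \o Y).
  apply: (@bounded_integrable _ _ _ _ (phi \o Y) c);
    last by move=> x; exact: phic.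
  by apply: measurableT_comp => //; exact: measurable_path.
have iX' : P'.-integrable setT ((EFin \o phi) \o Y').
  apply: (@bounded_integrable _ _ _ _ (phi \o Y') c);
    last by move=> x; exact: phic.
  by apply: measurableT_comp => //; exact: measurable_path.
rewrite /Rintegral; congr (fine _).
transitivity (\int[distribution P Y]_p (phi p)%:E)%E.
  by rewrite (integral_distribution mE iX).
rewrite -[RHS](integral_distribution mE iX').
apply: eq_measure_integral => A mA _.
apply: (@measure_unique _ R path_space path_cylinders (fun=> setT) erefl
  path_cylindersI _ _ (distribution P Y) (distribution P' Y')) => //.
- move=> _; exists 0%N, (fun _ _ => setT); split => //.
  apply/seteqP; split => [p _ /=|] //.
- by rewrite bigcup_const //; exists 0%N.
- by move=> _; rewrite (le_lt_trans (probability_le1 _ _)) ?ltry.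
Qed.

End PathSpace.
Arguments grid_path : clear implicits.
Arguments path_space : clear implicits.

Section BrownianLaw.
Context {R : realType} {K : nat}.

Section Increments.
Context {d : measure_display} {Om : measurableType d} (P : probability Om R).

Definition increments (B : 'I_K -> R -> Om -> R) (t : 'I_K -> nat -> R)
  (x : Om) : grid_path R K := fun j i => B j (t j i.+1) x - B j (t j i) x.

Lemma measurable_sigma_process (B : R -> Om -> R) (s : R) : 0 <= s <= 1 ->
  @measurable_fun _ _ (g_sigma_algebraType
    (\bigcup_(t in `[0, 1]%classic) preimage_set_system setT (B t) measurable))
    R setT (B s).
Proof.
move=> s01 _ A mA; apply: sub_sigma_algebra; exists s; last by exists A.
by rewrite /= in_itv.
Qed.

(** Independence is used twice: across the motions for the events E j, which
belong to the sigma-algebras of the processes, then across the increments of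
each motion. *)
Lemma prob_increments (B : 'I_K -> R -> Om -> R) (t : 'I_K -> nat -> R)
    (A : 'I_K -> nat -> set R) (n : nat) :
  independent_brownians P B ->
  (forall j i, 0 <= t j i <= 1) -> (forall j i, t j i <= t j i.+1) ->
  (forall j i, measurable (A j i)) ->
  (forall j i, (n <= i)%N -> A j i = setT) ->
  P (increments B t @^-1` path_rectangle A) =
  (\prod_j \prod_(i <- iota 0 n)
     P ((fun x => increments B t x j i) @^-1` A j i))%E.
Proof.
move=> [Bj indep] t01 tmon mA An.
pose E j := \bigcap_(i in [set` iota 0 n])
  ((fun x => increments B t x j i) @^-1` A j i).
have -> : increments B t @^-1` path_rectangle A =
    \bigcap_(j in [set` index_enum 'I_K]) E j.
  apply/seteqP; split=> x /=; first by move=> xA j _ i _; exact: xA.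
  move=> xE j i; have [ni|ni] := leqP n i; first by rewrite An.
  by apply: (xE j) => //=; rewrite ?mem_index_enum// mem_iota.
rewrite indep ?index_enum_uniq//.
  apply: eq_bigr => j _; have [_ _ incr _ _] := Bj j.
  rewrite [LHS](incr (t j)) ?iota_uniq// => i _.
  by exists (A j i) => //; rewrite setTI.
move=> j _; rewrite /sigma_process.
set G := \bigcup_(_ in _) _.
suff : @measurable _ (g_sigma_algebraType G) (E j) by [].
apply: bigcap_measurableType => i _.
rewrite -[X in measurable X]setTI.
apply: measurable_funB => //; exact: measurable_sigma_process.
Qed.

End Increments.

Section Marginals.
Context {d d' : measure_display} {Om : measurableType d}
  {Om' : measurableType d'} (P : probability Om R) (P' : probability Om' R).

(** Zero increments are treated apart: the Gaussian marginal is known for s < t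
only, and a null increment, or a null factor c, makes both sides constant. *)
Lemma brownian_increment_scale (B : R -> Om -> R) (B' : R -> Om' -> R)
    (c s t s' t' : R) (A : set R) :
  standard_brownian P B -> standard_brownian P' B' -> 0 <= c ->
  0 <= s -> s <= t -> t <= 1 -> 0 <= s' -> s' <= t' -> t' <= 1 ->
  Num.sqrt (t - s) = c * Num.sqrt (t' - s') -> measurable A ->
  P ((fun x => B t x - B s x) @^-1` A) =
  P' ((fun x => c * (B' t' x - B' s' x)) @^-1` A).
Proof.
move=> [_ _ _ BN _] [_ _ _ BN' _] c0 s0 st t1 s'0 st' t'1 E mA.
have const_law (d0 : measure_display) (T : measurableType d0)
    (Q : probability T R) :
    Q ((fun=> 0) @^-1` A) = (\1_A 0)%:E.
  rewrite indicE; have [A0|A0] := boolP (0 \in A).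
    rewrite (_ : _ @^-1` _ = setT) ?probability_setT//.
    by apply/seteqP; split=> // x _; exact: set_mem A0.
  rewrite (_ : _ @^-1` _ = set0) ?measure0//.
  by apply/seteqP; split=> // x A0'; rewrite mem_set in A0.
move: st; rewrite le_eqVlt => /predU1P[st|st].
  have st0 : (fun x => B t x - B s x) = (fun=> 0).
    by apply/funext => x; rewrite st subrr.
  have [c00|t's'] : c = 0 \/ t' = s'.
  - move/esym/eqP: E; rewrite st subrr sqrtr0 mulf_eq0 sqrtr_eq0.
    case/orP=> [/eqP|]; first by left.
    by move=> ?; right; lra.
  - have -> : (fun x => c * (B' t' x - B' s' x)) = (fun=> 0).
      by apply/funext => x; rewrite c00 mul0r.
    by rewrite st0 !const_law.
  - have -> : (fun x => c * (B' t' x - B' s' x)) = (fun=> 0).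
      by apply/funext => x; rewrite t's' subrr mulr0.
    by rewrite st0 !const_law.
have E0 : 0 < c * Num.sqrt (t' - s') by rewrite -E sqrtr_gt0 subr_gt0.
have c_gt0 : 0 < c.
  rewrite lt_neqAle c0 andbT eq_sym; apply: contraTneq E0 => ->.
  by rewrite mul0r ltxx.
have r_gt0 : 0 < Num.sqrt (t' - s') by move: E0; rewrite pmulr_rgt0.
have st't : s' < t' by move: r_gt0; rewrite sqrtr_gt0 subr_gt0.
rewrite (BN s t s0 st t1 A mA) E -normal_prob_scale//.
rewrite -(BN' s' t' s'0 st't t'1)//.
rewrite -[X in measurable X]setTI.
by apply: (measurable_funM (measurable_cst c) (@measurable_id _ R setT)).
Qed.

(** The values on the grid are the partial sums of the increments, up to the
null event where a motion does not start at 0; and the increments on both sides are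
independent with the same marginals. *)
Lemma brownian_scaling (B : 'I_K -> R -> Om -> R) (B' : 'I_K -> R -> Om' -> R)
    (t t' : 'I_K -> nat -> R) (c : 'I_K -> R) :
  independent_brownians P B -> independent_brownians P' B' ->
  (forall j, 0 <= c j) ->
  (forall j, t j 0%N = 0) -> (forall j i, 0 <= t j i <= 1) ->
  (forall j i, t j i <= t j i.+1) ->
  (forall j, t' j 0%N = 0) -> (forall j i, 0 <= t' j i <= 1) ->
  (forall j i, t' j i <= t' j i.+1) ->
  (forall j i, Num.sqrt (t j i.+1 - t j i)
     = c j * Num.sqrt (t' j i.+1 - t' j i)) ->
  forall (phi : path_space R K -> R) (b : R), measurable_fun setT phi ->
  (forall p, `|phi p| <= b) ->
  \int[P]_x phi (fun j i => B j (t j i) x) =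
  \int[P']_x phi (fun j i => c j * B' j (t' j i) x).
Proof.
move=> iB iB' c0 t0 t01 tmon t'0 t'01 t'mon tt' phi b mphi phib.
(* S rebuilds the values of a path from its increments. *)
pose S (p : grid_path R K) : grid_path R K :=
  fun j k => \sum_(0 <= i < k) p j i.
pose X := increments B t.
pose X' x : grid_path R K := fun j i => c j * increments B' t' x j i.
have mB j s : 0 <= s <= 1 -> measurable_fun setT (B j s).
  by move=> s01; have [/(_ j)[+ _ _ _ _] _] := iB; exact.
have mB' j s : 0 <= s <= 1 -> measurable_fun setT (B' j s).
  by move=> s01; have [/(_ j)[+ _ _ _ _] _] := iB'; exact.
have mX j i : measurable_fun setT (fun x => X x j i).
  by apply: measurable_funB; exact: mB.
have mX' j i : measurable_fun setT (fun x => X' x j i).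
  by apply: measurable_funM => //; apply: measurable_funB; exact: mB'.
have mS : measurable_fun setT (phi \o (S : path_space R K -> path_space R K)).
  apply: measurableT_comp => //; apply: measurable_path => j k.
  by apply: measurable_sum => i; exact: measurable_path_coord.
have law : \int[P]_x phi (S (X x)) = \int[P']_x phi (S (X' x)).
  apply: (path_law_unique mX mX' _ mS (fun p => phib (S p))).
  move=> _ [n [A [mA An ->]]].
  rewrite (prob_increments iB t01 tmon mA An).
  rewrite (_ : X' @^-1` _ = increments B' t' @^-1`
    path_rectangle (fun j i => (fun y => c j * y) @^-1` A j i)); last by [].
  rewrite (prob_increments (n := n) iB' t'01 t'mon); last first.
  - by move=> j i ni; rewrite An.
  - move=> j i; rewrite -[X in measurable X]setTI.
    by apply: (measurable_funM (measurable_cst (c j)) (@measurable_id _ R setT)).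
  apply: eq_bigr => j _; apply: eq_bigr => i _.
  have [/(_ j) Bj _] := iB; have [/(_ j) Bj' _] := iB'.
  apply: (brownian_increment_scale Bj Bj' (c0 j)) => //.
  - by have /andP[] := t01 j i.
  - by have /andP[] := t01 j i.+1.
  - by have /andP[] := t'01 j i.
  - by have /andP[] := t'01 j i.+1.
have telescope (f : nat -> R) k :
    \sum_(0 <= i < k) (f i.+1 - f i) = f k - f 0%N.
  exact: telescope_sumr.
have mphiB : measurable_fun setT (fun x => phi (fun j i => B j (t j i) x)).
  apply: (measurableT_comp mphi).
  by apply: measurable_path => j i; exact: mB.
have mphiB' : measurable_fun setT
    (fun x => phi (fun j i => c j * B' j (t' j i) x)).
  apply: (measurableT_comp mphi); apply: measurable_path => j i.
  by apply: measurable_funM => //; exact: mB'.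
have mphiX : measurable_fun setT (fun x => phi (S (X x))).
  exact: (measurableT_comp mS (measurable_path mX)).
have mphiX' : measurable_fun setT (fun x => phi (S (X' x))).
  exact: (measurableT_comp mS (measurable_path mX')).
have BS : \int[P]_x phi (fun j i => B j (t j i) x) = \int[P]_x phi (S (X x)).
  congr (fine _); apply: ae_eq_integral => //; do ?exact/measurable_EFinP.
  have : \forall x \ae P, forall j, B j 0 x = 0.
    by apply: filter_forall => j; have [/(_ j)[]] := iB.
  apply: filterS => x B0 _; congr (phi _)%:E.
  apply/funext => j; apply/funext => k.
  by rewrite /S telescope t0 B0 subr0.
have BS' : \int[P']_x phi (fun j i => c j * B' j (t' j i) x) =
    \int[P']_x phi (S (X' x)).
  congr (fine _); apply: ae_eq_integral => //; do ?exact/measurable_EFinP.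
  have : \forall x \ae P', forall j, B' j 0 x = 0.
    by apply: filter_forall => j; have [/(_ j)[]] := iB'.
  apply: filterS => x B0 _; congr (phi _)%:E.
  apply/funext => j; apply/funext => k.
  by rewrite /S -mulr_sumr telescope t'0 B0 subr0.
by rewrite BS BS'.
Qed.
End Marginals.
End BrownianLaw.

(** * Maxima over grids converge to suprema *)

Section GridSup.
Context {R : realType}.

Lemma cvg_sumr (I : finType) (f : R -> I -> R) (l : I -> R) :
  (forall i, f T i @[T --> +oo] --> l i) ->
  \sum_i f T i @[T --> +oo] --> \sum_i l i.
Proof.
move=> fl; elim: (index_enum I) => [|i r IH].
  by under eq_fun do rewrite big_nil; rewrite big_nil; exact: cvg_cst.
by under eq_fun do rewrite big_cons; rewrite big_cons; exact: cvgD.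
Qed.

(** The grid values need only be close to values of F, since the coefficients in
front of the processes still move with T. The maximum is bounded above by the
upper condition; a single near-maximizer of F, fed to the lower condition,
bounds it below. *)
Lemma cvg_bigmax_sup (S : Type) (D : set S) (F : S -> R) (C : R)
    (I : R -> finType) (V : forall T, I T -> R) :
  D !=set0 -> (forall s, D s -> 0 <= F s <= C) ->
  (forall e, 0 < e -> \forall T \near +oo, forall k : I T,
     exists2 s, D s & V T k <= F s + e) ->
  (forall s e, D s -> 0 < e -> \forall T \near +oo, exists k : I T,
     F s - e <= V T k) ->
  \big[Num.max/0]_(k : I T) V T k @[T --> +oo] --> sup [set F s | s in D].
Proof.
move=> [s0 Ds0] FC upper lower.
have hs : has_sup [set F s | s in D].
  split; first by exists (F s0), s0.
  by exists C => _ [s Ds <-]; have /andP[] := FC s Ds.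
have sup_ge s : D s -> F s <= sup [set F s | s in D].
  by move=> Ds; apply: sup_upper_bound => //; exists s.
apply/cvgrPdist_le => e e0.
have e20 : 0 < e / 2 by rewrite divr_gt0.
have [_ [s1 Ds1 <-] s1_sup] := sup_adherent e20 hs.
near=> T.
have up : \big[Num.max/0]_(k : I T) V T k <= sup [set F s | s in D] + e.
  apply/bigmax_leP; split => [|k _].
    apply: addr_ge0; last exact: ltW.
    by apply: le_trans (sup_ge s0 Ds0); have /andP[] := FC s0 Ds0.
  have /(_ k)[s Ds Vs] : forall k : I T, exists2 s, D s & V T k <= F s + e.
    by near: T; exact: upper.
  by rewrite (le_trans Vs)// lerD2r sup_ge.
have [k Vk] : exists k : I T, F s1 - e / 2 <= V T k.
  by near: T; exact: lower.
have Vmax : V T k <= \big[Num.max/0]_(k : I T) V T k by exact: le_bigmax.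
by rewrite ler_distlC; apply/andP; split => //; lra.
Unshelve. all: by end_near. Qed.

Lemma within_unit_bounded (g : R -> R) :
  {within `[0, 1]%classic, continuous g} ->
  exists C, forall s, 0 <= s <= 1 -> `|g s| <= C.
Proof.
move=> cg; have [c1 _ g1] := EVT_max ler01 cg.
have [c2 _ g2] := EVT_min ler01 cg.
exists (`|g c1| + `|g c2|) => s s01.
have {}s01 : s \in `[0, 1] by rewrite in_itv.
have := g1 s s01; have := g2 s s01; have := ler_norm (g c1).
have := lerNnormlW (lexx `|g c2|).
rewrite ler_norml => ? ? ? ?.
have := normr_ge0 (g c1); have := normr_ge0 (g c2).
by move=> ? ?; apply/andP; split; lra.
Qed.

Lemma truncn_grid_itv (n : nat) (s : R) : 0 <= s <= 1 ->
  (Num.truncn (s * n%:R) <= n)%N.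
Proof.
move=> /andP[s0 s1]; rewrite -(ler_nat R).
by apply: (@le_trans _ _ (s * n%:R)); rewrite ?truncn_le ?mulr_ge0 ?ler_piMl.
Qed.

Lemma grid_itv (n k : nat) : (k <= n)%N -> 0 <= (k%:R / n%:R : R) <= 1.
Proof.
move=> kn; rewrite divr_ge0//=; case: n kn => [|n] kn.
  by rewrite invr0 mulr0.
by rewrite ler_pdivrMr ?ltr0n// mul1r ler_nat.
Qed.

(** floor (s N) / N is within 1 / N below s, and never leaves [0, 1]. *)
Lemma cvg_grid (N : R -> nat) (g : R -> R) (s : R) :
  (N T)%:R @[T --> +oo] --> (+oo : set_system R) ->
  {within `[0, 1]%classic, continuous g} -> 0 <= s <= 1 ->
  g ((Num.truncn (s * (N T)%:R))%:R / (N T)%:R) @[T --> +oo] --> g s.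
Proof.
move=> N_oo cg s01.
have /subspace_continuousP/(_ s) := cg.
rewrite /= in_itv/= => /(_ s01) cgs.
apply: cvg_trans cgs => A.
rewrite /= /nbhs /= => -[e /= e0 eA].
have ei0 : 0 < e^-1 by rewrite invr_gt0.
have /cvgryPgt/(_ e^-1) Ne := N_oo.
near=> T.
have NT : e^-1 < (N T)%:R by near: T.
have N0 : 0 < (N T)%:R :> R by exact: lt_trans NT.
apply: eA => /=; last first.
  by rewrite in_itv/=; apply: grid_itv; exact: truncn_grid_itv.
have sN : 0 <= s * (N T)%:R by case/andP: s01 => s0 _; rewrite mulr_ge0.
have := truncn_itv sN => /andP[tl tr].
have ie : 1 / (N T)%:R < e.
  by rewrite ltr_pdivrMr// -ltr_pdivrMl// mulr1.
rewrite ltr_distlC; apply/andP; split.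
  rewrite (@lt_le_trans _ _ (s - 1 / (N T)%:R))//.
    by rewrite ltrD2l ltrN2.
  rewrite lerBlDr -mulrDl ler_pdivlMr//.
  by move: tr; rewrite -natr1 => /ltW.
rewrite (@le_lt_trans _ _ s)//; last by rewrite ltrDl.
by rewrite ler_pdivrMr.
Unshelve. all: by end_near. Qed.

Lemma cvg_grid_max (N : R -> nat) (g : R -> R) :
  (N T)%:R @[T --> +oo] --> (+oo : set_system R) ->
  {within `[0, 1]%classic, continuous g} -> (forall s, 0 <= g s) ->
  \big[Num.max/0]_(k < (N T).+1) g (k%:R / (N T)%:R) @[T --> +oo]
    --> sup [set g s | s in `[0, 1]].
Proof.
move=> N_oo cg g0; have [C gC] := within_unit_bounded cg.
apply: (@cvg_bigmax_sup _ _ _ C (fun T => 'I_(N T).+1)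
  (fun T k => g (k%:R / (N T)%:R))).
- by exists 0; rewrite /= in_itv/= lexx ler01.
- move=> s /=; rewrite in_itv/= => s01; rewrite g0/=.
  by rewrite (le_trans (ler_norm _))// gC.
- move=> e e0; apply: nearW => T k; exists (k%:R / (N T)%:R).
    by rewrite /= in_itv/=; apply: grid_itv; rewrite -ltnS.
  by rewrite lerDl ltW.
- move=> s e /=; rewrite in_itv/= => s01 e0.
  have /cvgrPdist_le/(_ e e0) := cvg_grid N_oo cg s01.
  apply: filterS => T; rewrite ler_distlC => /andP[+ _].
  have tN : (Num.truncn (s * (N T)%:R) < (N T).+1)%N.
    by rewrite ltnS; exact: truncn_grid_itv.
  by move=> gs; exists (Ordinal tN).
Qed.

(** The upper condition uses the convergence of the coefficients and the
boundedness of the g j; the lower one follows from [cvg_grid] by continuity of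
sums, products and absolute value. *)
Lemma cvg_grid_max_multi (K : nat) (N : R -> 'I_K -> nat) (a : R -> 'I_K -> R)
    (b : 'I_K -> R) (g : 'I_K -> R -> R) :
  (forall j, (N T j)%:R @[T --> +oo] --> (+oo : set_system R)) ->
  (forall j, a T j @[T --> +oo] --> b j) ->
  (forall j, {within `[0, 1]%classic, continuous (g j)}) ->
  \big[Num.max/0]_(k : {dffun forall j, 'I_(N T j).+1})
      `|\sum_j a T j * g j ((k j)%:R / (N T j)%:R)| @[T --> +oo]
    --> sup [set `|\sum_j b j * g j (s j)| | s in unit_cube K].
Proof.
move=> N_oo ab cg.
have /choice[C gC] : forall j, exists C, forall s, 0 <= s <= 1 -> `|g j s| <= C.
  by move=> j; exact: within_unit_bounded.
have C0 j : 0 <= C j.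
  by rewrite (le_trans _ (gC j 0 _))// lexx ler01.
apply: (@cvg_bigmax_sup _ _ _ (\sum_j `|b j| * C j)
  (fun T => {dffun forall j, 'I_(N T j).+1})
  (fun T k => `|\sum_j a T j * g j ((k j)%:R / (N T j)%:R)|)).
- by exists (fun=> 0) => j; rewrite lexx ler01.
- move=> s s01; rewrite normr_ge0/= (le_trans (ler_norm_sum _ _ _))//.
  by apply: ler_sum => j _; rewrite normrM ler_wpM2l// gC//; exact: s01.
- move=> e e0.
  have sum0 : \sum_j `|a T j - b j| * C j @[T --> +oo] --> \sum_(j < K) 0 * C j.
    apply: cvg_sumr => j; apply: cvgMl; rewrite -(@normr0 _ R).
    by apply: cvg_norm; apply/subr_cvg0.
  have sum0E : \sum_(j < K) 0 * C j = 0 by rewrite big1// => j _; rewrite mul0r.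
  rewrite sum0E in sum0; have /(_ _ _ e0) := cvgr_lt _ sum0.
  apply: filterS => T aTe k.
  exists (fun j => (k j)%:R / (N T j)%:R).
    by move=> j; apply: grid_itv; rewrite -ltnS.
  rewrite -lerBlDl (le_trans (lerB_dist _ _))// -sumrB.
  rewrite (le_trans (ler_norm_sum _ _ _))// (le_trans _ (ltW aTe))//.
  apply: ler_sum => j _; rewrite -mulrBl normrM ler_wpM2l// gC//.
  by apply: grid_itv; rewrite -ltnS.
- move=> s e s01 e0.
  have tN T j : (Num.truncn (s j * (N T j)%:R) < (N T j).+1)%N.
    by rewrite ltnS truncn_grid_itv//; exact: s01.
  have : `|\sum_j a T j * g j ((Num.truncn (s j * (N T j)%:R))%:R / (N T j)%:R)|
      @[T --> +oo] --> `|\sum_j b j * g j (s j)|.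
    apply: cvg_norm; apply: cvg_sumr => j; apply: cvgM; first exact: ab.
    exact: (cvg_grid (N_oo j) (cg j) (s01 j)).
  move=> /cvgrPdist_le/(_ e e0); apply: filterS => T.
  rewrite ler_distlC => /andP[gs _].
  exists (finfun (fun j => Ordinal (tN T j)) :
    {dffun forall j, 'I_(N T j).+1}).
  rewrite (le_trans gs)// le_eqVlt; apply/orP; left; apply/eqP; congr `|_|.
  by apply: eq_bigr => j _; rewrite [finfun _ j]ffunE.
Qed.

End GridSup.

(** * Functionals of Brownian motions on a grid *)

Lemma measurable_bigmax {R : realType} {d : measure_display}
    {T : measurableType d} (I : finType) (f : I -> T -> R) :
  (forall i, measurable_fun setT (f i)) ->
  measurable_fun setT (fun x => \big[Num.max/0]_i f i x).
Proof.
move=> mf; elim: (index_enum I) => [|i r IH].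
  by under eq_fun do rewrite big_nil; exact: measurable_cst.
by under eq_fun do rewrite big_cons; exact: measurable_maxr.
Qed.

Section StoppedGrid.
Context {R : realType}.
Implicit Types n m k : nat.

(** The grid k / m frozen from index n on, as the times of a path form an
infinite sequence in [0, 1] although only k <= n matters. *)
Definition stopped_grid n m k : R := (minn k n)%:R / m%:R.

Lemma stopped_grid0 n m : stopped_grid n m 0 = 0.
Proof. by rewrite /stopped_grid min0n mul0r. Qed.

Lemma stopped_grid_itv n m k : (n <= m)%N -> 0 <= stopped_grid n m k <= 1.
Proof. by move=> nm; apply: grid_itv; rewrite (leq_trans (geq_minr _ _)). Qed.

Lemma stopped_grid_le n m k : stopped_grid n m k <= stopped_grid n m k.+1.
Proof.
rewrite /stopped_grid ler_wpM2r ?invr_ge0// ler_nat.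
by rewrite leq_min geq_minr (leq_trans (geq_minl _ _)).
Qed.

Lemma stopped_gridE n m k : (k <= n)%N -> stopped_grid n m k = k%:R / m%:R.
Proof. by move=> kn; rewrite /stopped_grid (minn_idPl kn). Qed.

(** The standard deviations of the increments over the grids of steps 1 / m and
1 / n differ by the factor sqrt (n / m), also after the stopping index. *)
Lemma stopped_grid_scale n m k :
  Num.sqrt (stopped_grid n m k.+1 - stopped_grid n m k) =
  Num.sqrt (n%:R / m%:R)
    * Num.sqrt (stopped_grid n n k.+1 - stopped_grid n n k).
Proof.
rewrite -sqrtrM ?divr_ge0//; congr Num.sqrt.
rewrite /stopped_grid -!mulrBl; have [->|n0] := eqVneq n 0%N.
  by rewrite !minn0 subrr !mul0r.
by rewrite [n%:R / _]mulrC mulrACA divff ?pnatr_eq0// mulr1 mulrC.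
Qed.

End StoppedGrid.

Section FunctionalLimit.
Context {R : realType} {K : nat} {d d' : measure_display}
  {Om : measurableType d} {Om' : measurableType d'}.
Variables (P : probability Om R) (P' : probability Om' R).

(** The law of X T is that of Phi T along the fixed motions B', rescaled; the
latter converges surely to Y, hence in law, and [slutsky] passes from X to Z.
The sure convergence also yields the measurability of Y, a supremum of
uncountably many variables. *)
Lemma brownian_functional_limit (B : R -> 'I_K -> R -> Om -> R)
    (B' : 'I_K -> R -> Om' -> R) (N m : R -> 'I_K -> nat)
    (Phi : R -> path_space R K -> R) (Z X : R -> Om -> R) (Y : Om' -> R) :
  (forall T : R, 0 < T -> independent_brownians P (B T)) ->
  independent_brownians P' B' ->
  (forall T j, (N T j <= m T j)%N) ->
  (forall T, measurable_fun setT (Phi T)) ->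
  (forall T : R, 0 < T -> measurable_fun setT (Z T)) ->
  oP1 P (fun T x => `|Z T x - X T x|) ->
  (\forall T \near +oo, forall x, X T x =
     Phi T (fun j i => B T j (stopped_grid (N T j) (m T j) i) x)) ->
  (forall x, Phi T (fun j i => Num.sqrt ((N T j)%:R / (m T j)%:R)
       * B' j (stopped_grid (N T j) (N T j) i) x) @[T --> +oo] --> Y x) ->
  cvg_in_distribution P Z P' Y.
Proof.
move=> iB iB' Nm mPhi mZ ZX XPhi PhiY.
pose X' T x := Phi T (fun j i => Num.sqrt ((N T j)%:R / (m T j)%:R)
       * B' j (stopped_grid (N T j) (N T j) i) x).
have mX' T : measurable_fun setT (X' T).
  apply: (measurableT_comp (mPhi T)); apply: measurable_path => j i.
  apply: measurable_funM => //.
  by have [/(_ j)[+ _ _ _ _] _] := iB'; apply; exact: stopped_grid_itv.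
have mX : \forall T \near +oo, measurable_fun setT (X T).
  near=> T; have T0 : 0 < T by near: T; exact: nbhs_pinfty_gt.
  have -> : X T = fun x =>
      Phi T (fun j i => B T j (stopped_grid (N T j) (m T j) i) x).
    by apply/funext; near: T.
  apply: (measurableT_comp (mPhi T)); apply: measurable_path => j i.
  by have [/(_ j)[+ _ _ _ _] _] := iB T T0; apply; exact: stopped_grid_itv.
have mY : measurable_fun setT Y.
  apply: (@measurable_fun_cvg _ _ _ _ (fun n => X' n%:R)) => [n|x _].
    exact: mX'.
  exact: (cvg_comp (fun n => n%:R) (X'^~ x) (@cvgr_idn R) (PhiY x)).
split=> // f cf fb; have [c fc] := fb.
have mfY : measurable_fun setT (f \o Y) by exact: continuous_comp_measurable.
rewrite (expectation_Rintegral _ mfY (fun x => fc (Y x))).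
have ZY : \int[P]_x f (Z T x) @[T --> +oo] --> \int[P']_x f (Y x).
  apply: (slutsky mX _ mY _ ZX) => //.
    near=> T; apply: mZ; near: T; exact: nbhs_pinfty_gt.
  move=> {cf fb fc mfY}f cf [{}c fc].
  have : \int[P']_x f (X' T x) @[T --> +oo] --> \int[P']_x f (Y x).
    apply: (@bounded_convergence_pinfty _ _ _ _ _ _ c) => //.
    - by move=> T; exact: continuous_comp_measurable.
    - by move=> x; apply: (cvg_comp (X'^~ x) f) (PhiY x) (cf _).
  apply: cvg_trans; apply: near_eq_cvg; near=> T.
  have T0 : 0 < T by near: T; exact: nbhs_pinfty_gt.
  have -> : X T = fun x =>
      Phi T (fun j i => B T j (stopped_grid (N T j) (m T j) i) x).
    by apply/funext; near: T.
  apply/esym; apply: (brownian_scaling (iB T T0) iB' (c := fun j =>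
    Num.sqrt ((N T j)%:R / (m T j)%:R)) _ _ _ _ _ _ _ _ (phi := f \o Phi T)
    (b := c)) => //.
  - by move=> j; exact: stopped_grid0.
  - by move=> j i; exact: stopped_grid_itv.
  - by move=> j i; exact: stopped_grid_le.
  - by move=> j; exact: stopped_grid0.
  - by move=> j i; exact: stopped_grid_itv.
  - by move=> j i; exact: stopped_grid_le.
  - by move=> j i; exact: stopped_grid_scale.
  - exact: continuous_comp_measurable.
  - by move=> p; exact: fc.
have : (\int[P]_x f (Z T x))%:E @[T --> +oo] --> (\int[P']_x f (Y x))%:E.
  by apply: cvg_EFin; [exact: nearW|exact: ZY].
apply: cvg_trans; apply: near_eq_cvg; near=> T.
apply/esym/expectation_Rintegral; last by move=> x; exact: fc.
apply: continuous_comp_measurable => //.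
by apply: mZ; near: T; exact: nbhs_pinfty_gt.
Unshelve. all: by end_near. Qed.

End FunctionalLimit.

(** * The test statistics *)

Section StatisticsMeasurable.
Context {R : realType} {K : nat} (M : model R K) (v w : weights M).
Variable alpha : R -> 'I_K -> R.

Lemma measurable_prod_coord (j : 'I_K) :
  measurable_fun setT (fun x : prod_space (sample_space M) => x j).
Proof.
move=> _ A mA; apply: sub_sigma_algebra; exists j => //.
by exists A.
Qed.

Lemma measurable_Dsum T (j : 'I_K) k :
  measurable_fun setT (fun x : sample_space M j => Dsum v w T k x).
Proof.
have -> : (fun x : sample_space M j => Dsum v w T k x) = fun x =>
    \sum_nu (\sum_mu v T mu 0 * (\sum_(1 <= i < k.+1)
      (obs M T j i mu x * obs M T j i nu x - second_moment M T j i mu nu)))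
      * w T nu 0.
  apply/funext => x; rewrite /Dsum mxE; apply: eq_bigr => nu _.
  congr (_ * _); rewrite mxE; apply: eq_bigr => mu _.
  rewrite mxE summxE; congr (_ * _); apply: eq_bigr => i _.
  by rewrite !mxE big_ord1 !mxE.
apply: measurable_sum => nu; apply: measurable_funM => //.
apply: measurable_sum => mu; apply: measurable_funM => //.
apply: measurable_sum => i; apply: measurable_funB => //.
exact: measurable_funM.
Qed.

Lemma measurable_Dsum_coord T j k :
  measurable_fun setT
    (fun x : prod_space (sample_space M) => Dsum v w T k (x j)).
Proof.
exact: (@measurableT_comp _ _ _ _ _ _
  (fun y : sample_space M j => Dsum v w T k y) setT
  (fun x : prod_space (sample_space M) => x j)
  (measurable_Dsum T k) (measurable_prod_coord (j := j))).
Qed.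

Lemma measurable_Dproc_coord T j t :
  measurable_fun setT
    (fun x : prod_space (sample_space M) => Dproc v w T t (x j)).
Proof. by apply: measurable_funM => //; exact: measurable_Dsum_coord. Qed.

Lemma measurable_Deltaproc_coord T j t :
  measurable_fun setT
    (fun x : prod_space (sample_space M) => Deltaproc v w T t (x j)).
Proof.
apply: measurable_funB; first exact: measurable_Dproc_coord.
by apply: measurable_funM => //; exact: measurable_Dproc_coord.
Qed.

Lemma measurable_Dpooled T t : measurable_fun setT (Dpooled v w T t).
Proof.
apply: measurable_funM => //; apply: measurable_sum => j.
exact: measurable_Dsum_coord.
Qed.

Lemma measurable_Deltapooled T t : measurable_fun setT (Deltapooled v w T t).
Proof.
apply: measurable_funB; first exact: measurable_Dpooled.
apply: measurable_funM => //; apply: measurable_sum => j.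
by apply: measurable_funM => //; exact: measurable_Dproc_coord.
Qed.

Lemma measurable_Qstat T : measurable_fun setT (Qstat v w alpha T).
Proof.
apply: measurable_sum => j; apply: measurable_bigmax => k.
apply: measurable_funX; apply: measurable_funM => //.
exact: measurable_Dproc_coord.
Qed.

Lemma measurable_Qbreve T : measurable_fun setT (Qbreve v w alpha T).
Proof.
apply: measurable_sum => j; apply: measurable_bigmax => k.
apply: measurable_funX; apply: measurable_funM => //.
exact: measurable_Deltaproc_coord.
Qed.

Lemma measurable_Vstat T : measurable_fun setT (Vstat v w T).
Proof.
apply: measurable_bigmax => k; apply: measurableT_comp => //.
exact: measurable_Dpooled.
Qed.

Lemma measurable_Vbreve T : measurable_fun setT (Vbreve v w T).
Proof.
apply: measurable_bigmax => k; apply: measurableT_comp => //.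
exact: measurable_Deltapooled.
Qed.

End StatisticsMeasurable.

Section SampleSizes.
Context {R : realType} {K : nat} (M : model R K).

Lemma sample_size_cvgy j :
  (sample_size M T j)%:R @[T --> +oo] --> (+oo : set_system R).
Proof.
have /andP[f0 _] := freq_itv _ _ M j.
apply/cvgryPge => A; near=> T.
have AT : (A + 1) / freq M j <= T.
  by near: T; apply: nbhs_pinfty_ge; exact: num_real.
have : A + 1 <= freq M j * T by rewrite mulrC -ler_pdivrMr //.
by have := truncnS_gt (freq M j * T); rewrite -natr1 /sample_size => ? ?; lra.
Unshelve. all: by end_near. Qed.

Lemma sample_size_gt0_near :
  \forall T \near +oo, forall j, (0 < sample_size M T j)%N.
Proof.
apply: filter_forall => j; have /cvgryPgt/(_ 0) := sample_size_cvgy j.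
by apply: filterS => T; rewrite ltr0n.
Qed.

Lemma sample_size_le_total T j : (sample_size M T j <= total_size M T)%N.
Proof. by rewrite /total_size (bigD1 j)//= leq_addr. Qed.

End SampleSizes.

Section Bridge.
Context {R : realType} {d : measure_display} {Om : measurableType d}.

Lemma bridge_within_continuous (B : R -> Om -> R) x :
  {within `[0, 1]%classic, continuous (fun t => B t x)} ->
  {within `[0, 1]%classic, continuous (fun t => bridge B t x)}.
Proof.
move=> cB t; apply: cvgB; first exact: cB.
apply: cvgMl; apply: (continuous_subspaceT (f := idfun)).
by move=> ?; exact: cvg_id.
Qed.

Lemma sqr_within_continuous (g : R -> R) :
  {within `[0, 1]%classic, continuous g} ->
  {within `[0, 1]%classic, continuous (fun t => g t ^+ 2)}.
Proof. by move=> cg t; apply: cvgM; exact: cg. Qed.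

End Bridge.

Theorem lemma4p1 (R : realType) (K : nat) (K_gt0 : (0 < K)%N)
  (M : model R K) (v w : weights M)
  (v_bounded : l1_bounded v) (w_bounded : l1_bounded w)
  (alpha : R -> 'I_K -> R)
  (alpha_gt0 : forall (T : R) j, 0 < T -> 0 < alpha T j)
  (alpha_lrv : forall (T : R) j, 0 < T ->
    is_long_run_variance v w T j (alpha T j ^+ 2))
  (alphas kappa : 'I_K -> R)
  (alphas_gt0 : forall j, 0 < alphas j)
  (kappa_itv : forall j, 0 < kappa j <= 1)
  (alpha_cvg : forall j, alpha T j @[T --> +oo] --> alphas j)
  (kappa_cvg : forall j,
    (sample_size M T j)%:R / (total_size M T)%:R @[T --> +oo] --> kappa j)
  (P : probability (prod_space (sample_space M)) R)
  (P_product : is_product_probability (sample_prob M) P)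
  (approxQ : exists B : R -> 'I_K -> R -> prod_space (sample_space M) -> R,
    (forall T : R, 0 < T -> independent_brownians P (B T)) /\
    oP1 P (fun T x => `|Qstat v w alpha T x
      - \sum_j \big[Num.max/0]_(k < (sample_size M T j).+1)
          (B T j (k%:R / (sample_size M T j)%:R) x) ^+ 2|))
  (approxQbreve : exists B : R -> 'I_K -> R -> prod_space (sample_space M) -> R,
    (forall T : R, 0 < T -> independent_brownians P (B T)) /\
    oP1 P (fun T x => `|Qbreve v w alpha T x
      - \sum_j \big[Num.max/0]_(k < (sample_size M T j).+1)
          (bridge (B T j) (k%:R / (sample_size M T j)%:R) x) ^+ 2|))
  (approxV : exists B : R -> 'I_K -> R -> prod_space (sample_space M) -> R,
    (forall T : R, 0 < T -> independent_brownians P (B T)) /\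
    oP1 P (fun T x => `|Vstat v w T x
      - \big[Num.max/0]_(k : multi_index M T)
          `|\sum_j alpha T j * B T j ((k j)%:R / (total_size M T)%:R) x| |))
  (approxVbreve : exists B : R -> 'I_K -> R -> prod_space (sample_space M) -> R,
    (forall T : R, 0 < T -> independent_brownians P (B T)) /\
    oP1 P (fun T x => `|Vbreve v w T x
      - \big[Num.max/0]_(k : multi_index M T)
          `|\sum_j alpha T j
              * Num.sqrt ((sample_size M T j)%:R / (total_size M T)%:R)
              * bridge (B T j) ((k j)%:R / (sample_size M T j)%:R) x| |))
  (d : measure_display) (Om : measurableType d) (P' : probability Om R)
  (B : 'I_K -> R -> Om -> R) (B_brownian : independent_brownians P' B) :
  [/\ cvg_in_distribution P (Qstat v w alpha)
        P' (fun x => \sum_j sup [set (B j s x) ^+ 2 | s in `[0, 1]]),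
      cvg_in_distribution P (Vstat v w)
        P' (fun x => sup [set `|\sum_j alphas j * Num.sqrt (kappa j)
                                  * B j (s j) x| | s in unit_cube K]),
      cvg_in_distribution P (Qbreve v w alpha)
        P' (fun x => \sum_j sup [set (bridge (B j) s x) ^+ 2
                                | s in `[0, 1]])
    & cvg_in_distribution P (Vbreve v w)
        P' (fun x => sup [set `|\sum_j alphas j * Num.sqrt (kappa j)
                                  * bridge (B j) (s j) x|
                         | s in unit_cube K])].
Proof.
have cB j x : {within `[0, 1]%classic, continuous (fun t => B j t x)}.
  by have [/(_ j)[_ _ _ _ +] _] := B_brownian; exact.
have Ncvg j := sample_size_cvgy M j.
have mcoord := @measurable_path_coord R K.
have a_cvg j : alpha T j
    * Num.sqrt ((sample_size M T j)%:R / (total_size M T)%:R) @[T --> +oo]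
    --> alphas j * Num.sqrt (kappa j).
  apply: cvgM; first exact: alpha_cvg.
  by apply: (cvg_comp _ Num.sqrt (kappa_cvg j)); exact: sqrt_continuous.
(* With m = N_j the scaling factor is 1 as soon as N_j > 0. *)
have unit_scale T j : (0 < sample_size M T j)%N ->
    Num.sqrt ((sample_size M T j)%:R / (sample_size M T j)%:R) = 1 :> R.
  by move=> n0; rewrite divff ?sqrtr1// pnatr_eq0 -lt0n.
split.
- have [BT [iBT apx]] := approxQ.
  apply: (brownian_functional_limit (N := sample_size M) (m := sample_size M)
    (Phi := fun T p => \sum_j \big[Num.max/0]_(k < (sample_size M T j).+1)
       p j k ^+ 2) iBT B_brownian _ _ _ apx) => //.
  + move=> T; apply: measurable_sum => j; apply: measurable_bigmax => k.
    by apply: measurable_funX.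
  + by move=> T _; exact: measurable_Qstat.
  + apply: nearW => T x; apply: eq_bigr => j _; apply: eq_bigr => k _.
    by rewrite stopped_gridE// -ltnS.
  + move=> x.
    have : \sum_j \big[Num.max/0]_(k < (sample_size M T j).+1)
        B j (k%:R / (sample_size M T j)%:R) x ^+ 2 @[T --> +oo]
        --> \sum_j sup [set (B j s x) ^+ 2 | s in `[0, 1]].
      apply: cvg_sumr => j.
      apply: (cvg_grid_max (g := fun s => B j s x ^+ 2)) => //.
        exact: sqr_within_continuous.
      by move=> s; exact: sqr_ge0.
    apply: cvg_trans; apply: near_eq_cvg.
    apply: filterS (sample_size_gt0_near M) => T N0 /=.
    apply: eq_bigr => j _; apply: eq_bigr => k _.
    by rewrite unit_scale// mul1r stopped_gridE// -ltnS.
- have [BT [iBT apx]] := approxV.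
  (* The only case with two different grids: the factor sqrt (N_j / N) produced
     by the scaling is what turns the limit alphas j into
     alphas j * sqrt (kappa j). *)
  apply: (brownian_functional_limit (N := sample_size M)
    (m := fun T _ => total_size M T)
    (Phi := fun T p => \big[Num.max/0]_(k : multi_index M T)
       `|\sum_j alpha T j * p j (k j)|) iBT B_brownian _ _ _ apx).
  + by move=> T j; exact: sample_size_le_total.
  + move=> T; apply: measurable_bigmax => k; apply: measurableT_comp => //.
    by apply: measurable_sum => j; apply: measurable_funM.
  + by move=> T _; exact: measurable_Vstat.
  + apply: nearW => T x; apply: eq_bigr => k _; congr `|_|.
    by apply: eq_bigr => j _; rewrite stopped_gridE// -ltnS.
  + move=> x; have := cvg_grid_max_multi Ncvg a_cvg (cB^~ x).
    apply: cvg_trans; apply: near_eq_cvg; apply: nearW => T.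
    apply: eq_bigr => k _; congr `|_|; apply: eq_bigr => j _.
    by rewrite mulrA stopped_gridE// -ltnS.
- have [BT [iBT apx]] := approxQbreve.
  (* The bridge reads B at time 1, which is the last grid point once N_j > 0. *)
  apply: (brownian_functional_limit (N := sample_size M) (m := sample_size M)
    (Phi := fun T p => \sum_j \big[Num.max/0]_(k < (sample_size M T j).+1)
       (p j k - k%:R / (sample_size M T j)%:R * p j (sample_size M T j)) ^+ 2)
    iBT B_brownian _ _ _ apx) => //.
  + move=> T; apply: measurable_sum => j; apply: measurable_bigmax => k.
    apply: measurable_funX; apply: measurable_funB => //.
    by apply: measurable_funM.
  + by move=> T _; exact: measurable_Qbreve.
  + apply: filterS (sample_size_gt0_near M) => T N0 x.
    apply: eq_bigr => j _; apply: eq_bigr => k _.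
    have kN : (k <= sample_size M T j)%N by rewrite -ltnS.
    rewrite /bridge !stopped_gridE//.
    by rewrite divff// pnatr_eq0 -lt0n.
  + move=> x.
    have : \sum_j \big[Num.max/0]_(k < (sample_size M T j).+1)
        bridge (B j) (k%:R / (sample_size M T j)%:R) x ^+ 2 @[T --> +oo]
        --> \sum_j sup [set (bridge (B j) s x) ^+ 2 | s in `[0, 1]].
      apply: cvg_sumr => j.
      apply: (cvg_grid_max (g := fun s => bridge (B j) s x ^+ 2)) => //.
        exact/sqr_within_continuous/bridge_within_continuous.
      by move=> s; exact: sqr_ge0.
    apply: cvg_trans; apply: near_eq_cvg.
    apply: filterS (sample_size_gt0_near M) => T N0 /=.
    apply: eq_bigr => j _; apply: eq_bigr => k _.
    have kN : (k <= sample_size M T j)%N by rewrite -ltnS.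
    rewrite unit_scale// !mul1r /bridge !stopped_gridE//.
    by rewrite divff// pnatr_eq0 -lt0n.
- have [BT [iBT apx]] := approxVbreve.
  apply: (brownian_functional_limit (N := sample_size M) (m := sample_size M)
    (Phi := fun T p => \big[Num.max/0]_(k : multi_index M T)
       `|\sum_j alpha T j
           * Num.sqrt ((sample_size M T j)%:R / (total_size M T)%:R)
           * (p j (k j)
              - (k j)%:R / (sample_size M T j)%:R * p j (sample_size M T j))|)
    iBT B_brownian _ _ _ apx) => //.
  + move=> T; apply: measurable_bigmax => k; apply: measurableT_comp => //.
    apply: measurable_sum => j; apply: measurable_funM => //.
    by apply: measurable_funB => //; apply: measurable_funM.
  + by move=> T _; exact: measurable_Vbreve.
  + apply: filterS (sample_size_gt0_near M) => T N0 x.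
    apply: eq_bigr => k _; congr `|_|; apply: eq_bigr => j _.
    have kN : (k j <= sample_size M T j)%N by rewrite -ltnS.
    rewrite /bridge !stopped_gridE//.
    rewrite [(sample_size M T j)%:R / (sample_size M T j)%:R]divff//.
    by rewrite pnatr_eq0 -lt0n.
  + move=> x.
    have := cvg_grid_max_multi Ncvg a_cvg
      (fun j => bridge_within_continuous (cB j x)).
    apply: cvg_trans; apply: near_eq_cvg.
    apply: filterS (sample_size_gt0_near M) => T N0 /=.
    apply: eq_bigr => k _; congr `|_|; apply: eq_bigr => j _.
    have kN : (k j <= sample_size M T j)%N by rewrite -ltnS.
    rewrite unit_scale// !mul1r /bridge !stopped_gridE//.
    rewrite [(sample_size M T j)%:R / (sample_size M T j)%:R]divff//.
    by rewrite pnatr_eq0 -lt0n.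
Qed.
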